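(* Let $K$ be a PL sphere on the vertex set $[m]=\{1,\dots,m\}$ with $\dim(K)=n-1$, such that $\{1,\dots,n\}$ is a maximal face of $K$. Let $\lambda_1,\lambda_2\in \mathrm{CM}(K)$, represented by their normal forms $\lambda_i=(I_n\mid M_i)$ with $M_i$ an $n\times(m-n)$ matrix over $\mathbb{Z}_2$, and let $p\in[m]$. Then the following are equivalent: (1) There exists $\lambda\in \mathrm{CM}(\mathrm{wed}_p(K))$ such that $\lambda=\lambda_1\wedge_p\lambda_2$. (2) There exists a row vector $\psi$ over $\mathbb{Z}_2$ of size $m-n$ such that $\bar\lambda_2=h\bar\lambda_1$, where $$h=\begin{pmatrix} I_n & A\\ 0 & I_{m-n}\end{pmatrix}\in\mathcal{M}(m,m,\mathbb{Z}_2),$$ $A$ is the $n\times(m-n)$ matrix whose $i$-th row is $\lambda_1(p)_i\,\psi$ for $i=1,\dots,n$, and $\bar\lambda_i$ denotes the $m\times(m-n)$ matrix $\begin{pmatrix} M_i\\ I_{m-n}\end{pmatrix}$ for $i=1,2$.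
   Context: $\mathbb{Z}_2=\mathbb{Z}/2$, and $\mathcal{M}(a,b,\mathbb{Z}_2)$ is the set of $a\times b$ matrices over $\mathbb{Z}_2$. Let $K$ be a pure simplicial complex of dimension $n-1$ on vertex set $V$. A (mod 2) characteristic map over $K$ is a map $\lambda:V\to\mathbb{Z}_2^n$ such that whenever $\{i_1,\dots,i_n\}\in K$ is a maximal face, $\lambda(i_1),\dots,\lambda(i_n)$ are linearly independent (non-singularity). When $V=[m]$ it is identified with the $n\times m$ matrix with columns $\lambda(1),\dots,\lambda(m)$. $\mathrm{GL}(n,\mathbb{Z}_2)$ acts by left multiplication; the orbits are called DJ classes and $\mathrm{CM}(K)$ is the set of DJ classes. If $\{1,\dots,n\}$ is a maximal face, each DJ class has a unique representative $(I_n\mid M)$; $\lambda(p)_i$ denotes the $i$-th coordinate of the $p$-th column of this representative. The matrix $\bar\lambda=\begin{pmatrix}M\\ I_{m-n}\end{pmatrix}$ is the corresponding representative of the dual characteristic map (its columns form a basis of $\ker\lambda$, and its rows are $\bar\lambda(1),\dots,\bar\lambda(m)$). For a vertex $p$ of $K$, the wedge of $K$ at $p$ is the complex on $(V\setminus\{p\})\cup\{p_1,p_2\}$ given by $\mathrm{wed}_p(K)=(I*\mathrm{Lk}_K(p))\cup(\partial I*(K\setminus\{p\}))$, where $I$ is the 1-simplex with vertices $p_1,p_2$, $K\setminus\{p\}=\{\sigma\in K: p\notin\sigma\}$, and $\mathrm{Lk}_K(\sigma)=\{\tau\in K:\sigma\cup\tau\in K,\ \sigma\cap\tau=\emptyset\}$.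 The links of $p_1$ and of $p_2$ in $\mathrm{wed}_p(K)$ are copies of $K$ (with $p$ replaced by $p_2$, respectively $p_1$). For a characteristic map $\lambda$ over a complex $K$ of dimension $n-1$ and a face $\sigma$ of $K$, the projection $\mathrm{Proj}_\sigma\lambda$ is the characteristic map over $\mathrm{Lk}_K(\sigma)$ given by $s\mapsto[\lambda(s)]\in\mathbb{Z}_2^n/\langle\lambda(v):v\in\sigma\rangle\cong\mathbb{Z}_2^{n-|\sigma|}$. It is well defined on DJ classes. For a vertex $p$, write $\mathrm{Proj}_p=\mathrm{Proj}_{\{p\}}$. For $\lambda\in\mathrm{CM}(\mathrm{wed}_p(K))$, the notation $\lambda=\lambda_1\wedge_p\lambda_2$ means $\mathrm{Proj}_{p_2}(\lambda)=\lambda_1$ and $\mathrm{Proj}_{p_1}(\lambda)=\lambda_2$ in $\mathrm{CM}(K)$ (where $\mathrm{Lk}_{\mathrm{wed}_p(K)}(p_2)$ is identified with $K$ by renaming $p_1$ to $p$, and $\mathrm{Lk}_{\mathrm{wed}_p(K)}(p_1)$ is identified with $K$ by renaming $p_2$ to $p$, all other vertices being fixed); such $\lambda$ is uniquely determined by $\lambda_1,\lambda_2$ when it exists. *)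

(* Defs.v *)
From HB Require Import structures.
From mathcomp Require Import all_boot all_order all_algebra.
From mathcomp Require Import reals.

Set Implicit Arguments.
Unset Strict Implicit.
Unset Printing Implicit Defensive.

Import Order.TTheory GRing.Theory Num.Theory.
Local Open Scope ring_scope.

(* The field Z/2 is 'F_2.  A simplicial complex is a set of faces over an
   ambient finite type V; its vertices are the v with [set v] \in K, so an
   element of V need not be a vertex (for instance in a link). *)

Section Complexes.
Variable V : finType.
Implicit Types (K : {set {set V}}) (s t : {set V}).

Definition simplicial_complex K : Prop :=
  set0 \in K /\ (forall s t, s \in K -> t \subset s -> t \in K).

Definition vertices K : {set V} := [set v | [set v] \in K].

Definition facet K s : Prop :=
  s \in K /\ (forall t, t \in K -> s \subset t -> t = s).

(* Dimension is shifted by one: pure_complex K n says that K is pure of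
   dimension n - 1. *)
Definition pure_complex K (n : nat) : Prop := forall s, facet K s -> #|s| = n.

Definition link K s : {set {set V}} :=
  [set t in K | (s :|: t \in K) && [disjoint s & t]].

Definition deletion K (p : V) : {set {set V}} := [set s in K | p \notin s].

End Complexes.

Definition full_simplex (V : finType) : {set {set V}} := [set: {set V}].

Definition boundary_simplex (V : finType) : {set {set V}} :=
  [set s : {set V} | s != [set: V]].

Definition join (V W : finType) (K : {set {set V}}) (L : {set {set W}}) :
    {set {set (V + W)%type}} :=
  [set (inl @: s) :|: (inr @: t) | s : {set V} in K, t : {set W} in L].

(* Points of the geometric realization |K|, in barycentric coordinates. *)
Definition realization (R : realType) (V : finType) (K : {set {set V}})
    (x : {ffun V -> R}) : bool :=
  [&& [forall v, 0 <= x v], \sum_v x v == 1 & [set v | x v != 0] \in K].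

(* The abstract complex K' triangulates |K| as a linear subdivision of K: its
   vertices w are placed at points f w of |K|, every simplex of K' lands in a
   single simplex of K, and the induced map |K'| -> |K|, affine on each simplex
   of K', is a bijection (hence a homeomorphism, |K'| being compact). *)
Definition subdivides (R : realType) (W V : finType)
    (K' : {set {set W}}) (K : {set {set V}}) : Prop :=
  exists f : W -> {ffun V -> R},
    [/\ forall w, w \in vertices K' -> realization K (f w),
        forall s, s \in K' -> exists2 t, t \in K &
          forall w v, w \in s -> f w v != 0 -> v \in t
      & forall y, realization K y ->
          exists! x : {ffun W -> R},
            realization K' x /\ (forall v, y v = \sum_w x w * f w v)].

(* Two complexes are PL homeomorphic when they have isomorphic subdivisions,
   i.e. when one abstract complex subdivides both. *)
Definition PL_homeomorphic (R : realType) (V1 V2 : finType)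
    (K1 : {set {set V1}}) (K2 : {set {set V2}}) : Prop :=
  exists (W : finType) (K' : {set {set W}}),
    [/\ simplicial_complex K', subdivides R K' K1 & subdivides R K' K2].

Definition PL_sphere (R : realType) (V : finType) (K : {set {set V}}) : Prop :=
  simplicial_complex K /\
  exists d : nat, PL_homeomorphic R K (boundary_simplex 'I_d.+1).

Section CharacteristicMaps.
Variable V : finType.
Implicit Types (K : {set {set V}}) (s : {set V}).

(* A map from the vertices of K to (Z/2)^n is encoded as a function on V that
   vanishes off the vertices of K. *)
Definition characteristic_map K (n : nat) (l : {ffun V -> 'cV['F_2]_n}) : Prop :=
  (forall v, v \notin vertices K -> l v = 0) /\
  (forall s, facet K s -> #|s| = n -> free [seq l v | v in s]).

Definition DJ_class (n : nat) (l : {ffun V -> 'cV['F_2]_n}) :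
    {set {ffun V -> 'cV['F_2]_n}} :=
  [set [ffun v => g *m l v] | g : 'M['F_2]_n in unitmx].

(* Membership of a DJ class in CM(K), for K of dimension n - 1. *)
Definition CM K (n : nat) (X : {set {ffun V -> 'cV['F_2]_n}}) : Prop :=
  exists2 l, characteristic_map K l & X = DJ_class l.

(* q presents the quotient of (Z/2)^n by the span of l(s) as (Z/2)^r: it is
   onto, with kernel that span. *)
Definition quotient_map (n r : nat) (l : {ffun V -> 'cV['F_2]_n}) s
    (q : 'M['F_2]_(r, n)) : bool :=
  [forall y : 'cV['F_2]_r, [exists x : 'cV['F_2]_n, q *m x == y]] &&
  [forall x : 'cV['F_2]_n,
     (q *m x == 0) == (x \in <<[seq l v | v in s]>>%VS)].

(* Proj_s on DJ classes.  All identifications of the quotient with (Z/2)^r are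
   allowed; they form one GL(r, Z/2)-orbit.  When l(s) is linearly independent,
   r = n - #|s| is forced (the set is empty for any other r). *)
Definition Proj K s (n r : nat) (X : {set {ffun V -> 'cV['F_2]_n}}) :
    {set {ffun V -> 'cV['F_2]_r}} :=
  [set [ffun v => if v \in vertices (link K s) then q *m (l v) else 0]
     | l : {ffun V -> 'cV['F_2]_n} in X,
       q : 'M['F_2]_(r, n) in [pred q | quotient_map l s q]].

End CharacteristicMaps.

Definition columns (n m : nat) (L : 'M['F_2]_(n, m)) :
    {ffun 'I_m -> 'cV['F_2]_n} := [ffun v => col v L].

Section Wedge.
Variables (V : finType) (p : V).

(* (V \ {p}) with two new vertices p_1 = inl false and p_2 = inl true. *)
Definition wedge_vertex : finType := (bool + {v : V | v != p})%type.

Definition wedge_p1 : wedge_vertex := inl false.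
Definition wedge_p2 : wedge_vertex := inl true.

Definition off_p (L : {set {set V}}) : {set {set {v : V | v != p}}} :=
  [set s : {set {v : V | v != p}} | [set val v | v in s] \in L].

Definition wed (K : {set {set V}}) : {set {set wedge_vertex}} :=
  join (full_simplex bool) (off_p (link K [set p]))
  :|: join (boundary_simplex bool) (off_p (deletion K p)).

(* The renaming V -> wedge_vertex that sends p to c and fixes the rest. *)
Definition rename (c : wedge_vertex) (v : V) : wedge_vertex :=
  if insub v is Some u then inr u else c.

Definition pullback (c : wedge_vertex) (n : nat)
    (X : {set {ffun wedge_vertex -> 'cV['F_2]_n}}) :
    {set {ffun V -> 'cV['F_2]_n}} :=
  [set [ffun v => l (rename c v)]
     | l : {ffun wedge_vertex -> 'cV['F_2]_n} in X].

(* X = X1 /\_p X2. *)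
Definition is_wedge (K : {set {set V}}) (n : nat)
    (X : {set {ffun wedge_vertex -> 'cV['F_2]_n.+1}})
    (X1 X2 : {set {ffun V -> 'cV['F_2]_n}}) : Prop :=
  pullback wedge_p1 (Proj (wed K) [set wedge_p2] n X) = X1 /\
  pullback wedge_p2 (Proj (wed K) [set wedge_p1] n X) = X2.

End Wedge.

(* Main.v *)
Require Import Defs.
From HB Require Import structures.
From mathcomp Require Import all_boot all_order all_algebra.
From mathcomp Require Import reals.

Set Implicit Arguments.
Unset Strict Implicit.
Unset Printing Implicit Defensive.

Import Order.TTheory GRing.Theory Num.Theory.
Local Open Scope ring_scope.

(** Write L_i = (I | M_i), with columns L_i(v), and c = L_1(p).  Multiplying out
    the block matrices, the second condition says that L_2 = L_1 + c (0 | psi):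
    every column of L_2 is the corresponding column of L_1 plus a multiple of c,
    with multiplier 0 on the first n columns ([block_shearE]).  So the theorem
    compares two projections of one map on the wedge up to multiples of c.

    From a wedge to psi.  Suppose that l on the wedge has projection L_1 through
    q1, killing l(p_2), and projection L_2 through q2, killing l(p_1).  Lift the
    unit vectors to the vectors l(i), i <= n, with p_1 in place of p if p <= n.
    This gives a section B of q1, so each vector x equals B (q1 x) plus a
    multiple of l(p_2).  Applying q2, which sends l(p_2) to L_2(p) and each
    lift l(i) to e_i (except that the lift of e_p goes to 0 if p <= n),
    expresses q2 x as q1 x plus multiples of c and of L_2(p).  Finally
    L_2(p) = c: if p <= n both are e_p, and otherwise the formula at
    x = l(p_1) says that c is a multiple of L_2(p), and c is not 0
    ([projections_differ_by_shear]).

    From psi to a wedge.  In (Z/2)^(1+n) put p_2 at (1, 0), p_1 at (1, c), and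
    any other v at (a_v, L_1(v)), where a = (0 | psi).  The map (t, x) |-> x
    kills p_2 and gives L_1; the map (t, x) |-> x + t c kills p_1 and gives L_2
    ([projections_of_shear]).  This labelling is non-singular because every
    face of the wedge lies in the cone, with apex one of p_1 and p_2, over a copy
    of a face of K in which p is renamed to the other one ([wedP]).
    Independence on such a cone follows from independence of the projection
    on the face of K ([free_star], [wed_free]).

    Both directions pass between projections as sets of classes and individual
    quotient maps: two quotient maps with the same kernel differ by GL
    ([quotient_map_unique]), so the projection of a class is the class of any
    single projected map ([pullback_Proj]). *)

(** * Linear algebra *)

Lemma F2_neq0 (t : 'F_2) : t != 0 -> t = 1.
Proof. by case: t => -[|[|//]] lt_t nz; apply/val_inj. Qed.

Section FreeFamilies.
Variables (F : fieldType) (vT : vectType F).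

(** Freeness of a family indexed by a finite set, with coefficients indexed by
    the elements themselves instead of by their ranks in the enumeration. *)
Lemma free_imageP (V : finType) (f : V -> vT) (s : {set V}) :
  free [seq f v | v in s] <->
  (forall a : V -> F, \sum_(v in s) a v *: f v = 0 ->
     forall v, v \in s -> a v = 0).
Proof.
pose X : #|s|.-tuple vT := [tuple of [seq f v | v in s]].
split=> [/(@freeP _ _ _ X) frX a sum0 v sv | frf].
  have /frX/(_ (enum_rank_in sv v)): \sum_(i < #|s|) a (enum_val i) *: X`_i = 0.
    rewrite -[RHS]sum0 [RHS]big_enum_val.
    by apply: eq_bigr => i _; rewrite (nth_image 0).
  by rewrite enum_rankK_in.
apply/(@freeP _ _ _ X) => b sum0 i.
pose a v := b (enum_rank_in (enum_valP i) v).
have aE j : a (enum_val j) = b j by rewrite /a enum_valK_in.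
rewrite -aE; apply: frf (enum_valP i); rewrite big_enum_val -[RHS]sum0.
by apply: eq_bigr => j _; rewrite aE (nth_image 0).
Qed.

Lemma free_image_sub (V : finType) (f : V -> vT) (s t : {set V}) :
  s \subset t -> free [seq f v | v in t] -> free [seq f v | v in s].
Proof.
move=> /subsetP sub_st /free_imageP frt; apply/free_imageP => a sum0 v sv.
have /frt/(_ v (sub_st v sv)):
    \sum_(u in t) (if u \in s then a u else 0) *: f u = 0.
  rewrite -[RHS]sum0 [RHS]big_mkcond [LHS]big_mkcond.
  apply: eq_bigr => u _; have := sub_st u.
  by case: (u \in s) => [->//|_]; rewrite scale0r if_same.
by rewrite sv.
Qed.

Lemma free_image_neq0 (V : finType) (f : V -> vT) (s : {set V}) v :
  free [seq f u | u in s] -> v \in s -> f v != 0.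
Proof.
move=> /free_imageP frs sv; apply/eqP => fv0.
have /frs/(_ v sv)/eqP: \sum_(u in s) (u == v)%:R *: f u = 0.
  rewrite big1 // => u _.
  by case: eqP => [->|_]; rewrite ?fv0 ?scaler0 ?scale0r.
by rewrite eqxx oner_eq0.
Qed.

End FreeFamilies.

Lemma free_mulmx_unit (F : fieldType) (V : finType) (n : nat) (g : 'M[F]_n)
    (l : V -> 'cV[F]_n) (s : {set V}) :
  g \in unitmx -> free [seq l v | v in s] -> free [seq g *m l v | v in s].
Proof.
move=> ug /free_imageP frs; apply/free_imageP => a sum0; apply: frs.
rewrite -[LHS](mulKmx ug) mulmx_sumr -[RHS](mulmx0 _ (invmx g)) -[in RHS]sum0.
by congr (_ *m _); apply: eq_bigr => v _; rewrite scalemxAr.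
Qed.

(** Independence lifts along a quotient: if q kills l(c), a relation among l(c)
    and the l(f v) becomes under q a relation among the q l(f v) alone, hence is
    trivial there, and what remains is a multiple of the nonzero l(c). *)
Lemma free_star (F : fieldType) (V W : finType) (n r : nat) (l : W -> 'cV[F]_n)
    (q : 'M[F]_(r, n)) (c : W) (f : V -> W) (s : {set V}) :
    injective f -> (forall v, f v != c) -> q *m l c = 0 -> l c != 0 ->
    free [seq q *m l (f v) | v in s] ->
  free [seq l w | w in c |: f @: s].
Proof.
move=> injf fNc qc0 lc_n0 /free_imageP frs; apply/free_imageP => a.
have cNfs : c \notin f @: s.
  by apply/imsetP => -[v _ /esym/eqP]; apply/negP.
rewrite big_setU1 //= big_imset /=; last by move=> ? ? _ _; apply: injf.
move=> sum0.
have a0 v : v \in s -> a (f v) = 0.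
  apply: (frs (fun v => a (f v))).
  have := congr1 (mulmx q) sum0.
  rewrite mulmx0 mulmxDr -scalemxAr qc0 scaler0 add0r mulmx_sumr => qsum0.
  rewrite -[RHS]qsum0.
  by apply: eq_bigr => u _; rewrite scalemxAr.
move: sum0; rewrite big1 ?addr0 => [|v /a0->]; last by rewrite scale0r.
move=> /eqP; rewrite scaler_eq0 (negPf lc_n0) orbF => /eqP ac0 w.
by rewrite !inE => /orP[/eqP->//|/imsetP[v sv ->]]; apply: a0.
Qed.

Lemma col_mulmx (F : fieldType) (m n r : nat) (A : 'M[F]_(m, n))
    (B : 'M[F]_(n, r)) j : col j (A *m B) = A *m col j B.
Proof. by rewrite !colE mulmxA. Qed.

Lemma eq_col_matrix (T : Type) (m n : nat) (A B : 'M[T]_(m, n)) :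
  (forall j, col j A = col j B) -> A = B.
Proof. by move=> eqAB; apply/matrixP => i j; apply: col_eq i. Qed.

(** * DJ classes and quotient maps *)

Section DJClasses.
Variables (V : finType) (n : nat).
Implicit Types (K : {set {set V}}) (l : {ffun V -> 'cV['F_2]_n}).

Lemma DJ_class_refl l : l \in DJ_class l.
Proof.
apply/imsetP; exists 1%:M; first exact: unitmx1.
by apply/ffunP => v; rewrite ffunE mul1mx.
Qed.

Lemma DJ_class_sub l l' : l' \in DJ_class l -> DJ_class l' \subset DJ_class l.
Proof.
move=> /imsetP[g ug ->]; apply/subsetP => _ /imsetP[h uh ->].
apply/imsetP; exists (h *m g); first by rewrite unitmx_mul; apply/andP.
by apply/ffunP => v; rewrite !ffunE mulmxA.
Qed.

Lemma DJ_class_sym l l' : l' \in DJ_class l -> l \in DJ_class l'.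
Proof.
move=> /imsetP[g ug ->]; apply/imsetP; exists (invmx g).
  by rewrite unitmx_inv.
by apply/ffunP => v; rewrite !ffunE mulKmx.
Qed.

Lemma DJ_class_eq l l' : l' \in DJ_class l -> DJ_class l' = DJ_class l.
Proof.
by move=> l'l; apply/eqP; rewrite eqEsubset !DJ_class_sub // DJ_class_sym.
Qed.

Lemma CM_mem K (X : {set {ffun V -> 'cV['F_2]_n}}) l :
  CM K X -> l \in X -> characteristic_map K l /\ X = DJ_class l.
Proof.
move=> [l0 [l0_out l0_fr] ->] l_l0; rewrite (DJ_class_eq l_l0).
case/imsetP: l_l0 => g ug ->; split=> //; split=> [v /l0_out|s /l0_fr + card_s].
  by rewrite ffunE => ->; rewrite mulmx0.
move=> /(_ card_s)/(free_mulmx_unit ug).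
by under [X in _ -> is_true (free X)]eq_image do [by []|rewrite ffunE].
Qed.

(** Non-singularity is imposed on facets; by purity every face lies in one of
    the right size, so independence passes to all faces. *)
Lemma characteristic_map_free K l s :
  pure_complex K n -> characteristic_map K l -> s \in K ->
  free [seq l v | v in s].
Proof.
move=> pureK [_ l_fr] Ks.
have [t /maxsetP[Kt t_max] sub_st] := @maxset_exists _ [in K] s Ks.
have facet_t : facet K t by [].
exact: free_image_sub sub_st (l_fr t facet_t (pureK t facet_t)).
Qed.

(** For a single vertex c the defining conditions of a quotient map take a form
    suited to matrix computation: onto becomes the existence of a section. *)
Lemma quotient_mapP (r : nat) l c (q : 'M['F_2]_(r, n)) :
  quotient_map l [set c] q <->
  [/\ exists B : 'M_(n, r), q *m B = 1%:M, q *m l c = 0 &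
      forall x, q *m x = 0 -> exists t, x = t *: l c].
Proof.
have spanE x : (x \in <<[seq l v | v in [set c]]>>%VS) = (x \in <[l c]>%VS).
  by rewrite /image_mem enum_set1 span_seq1.
split=> [/andP[/forallP q_onto /forallP q_ker] | [[B qB] qc0 q_ker]].
  split.
  - have /fin_all_exists[b qb] j : exists x, q *m x = col j 1%:M.
      by have /existsP[x /eqP] := q_onto (col j 1%:M); exists x.
    exists (\matrix_(i, j) b j i 0); apply: eq_col_matrix => j.
    rewrite col_mulmx -qb; congr (_ *m _).
    by apply/matrixP => i z; rewrite !mxE ord1.
  - by apply/eqP; rewrite (eqP (q_ker _)) spanE memv_line.
  by move=> x /eqP; rewrite (eqP (q_ker _)) spanE => /vlineP.
apply/andP; split; apply/forallP => x.
  by apply/existsP; exists (B *m x); rewrite mulmxA qB mul1mx.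
rewrite spanE; apply/eqP; apply/eqP/vlineP => [/q_ker//|[t ->]].
by rewrite -scalemxAr qc0 scaler0.
Qed.

(** With B a section of q, the change of basis is q' B: the difference
    x - B (q x) lies in ker q, so q' kills it too, and q' = (q' B) q.  A section
    of q' then shows that q' B is invertible. *)
Lemma quotient_map_unique (r : nat) l c (q q' : 'M['F_2]_(r, n)) :
  quotient_map l [set c] q -> quotient_map l [set c] q' ->
  exists2 g, g \in unitmx & q' = g *m q.
Proof.
move=> /quotient_mapP[[B qB] _ q_ker] /quotient_mapP[[B' qB'] qc0 _].
have q'E : q' = (q' *m B) *m q.
  apply: eq_col_matrix => j; rewrite -!mulmxA col_mulmx !colE mulmxA.
  set x := delta_mx j 0.
  have /q_ker[t xE] : q *m (x - B *m (q *m x)) = 0.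
    by rewrite mulmxBr (mulmxA q B) qB mul1mx subrr.
  apply/eqP; rewrite -subr_eq0 -!mulmxA -mulmxBr xE -scalemxAr qc0.
  by rewrite scaler0.
exists (q' *m B) => //.
have gK : (q' *m B) *m (q *m B') = 1%:M by rewrite mulmxA -q'E.
by have [] := mulmx1_unit gK.
Qed.

Lemma quotient_map_mull (r : nat) l s (g : 'M['F_2]_r) (q : 'M['F_2]_(r, n)) :
  g \in unitmx -> quotient_map l s q -> quotient_map l s (g *m q).
Proof.
move=> ug /andP[/forallP q_onto /forallP q_ker].
apply/andP; split; apply/forallP => x.
  have /existsP[y /eqP qy] := q_onto (invmx g *m x).
  by apply/existsP; exists y; rewrite -mulmxA qy mulKVmx.
rewrite -(eqP (q_ker x)) -mulmxA; apply/eqP.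
apply/eqP/eqP => [gqx0|->]; last by rewrite mulmx0.
by rewrite -[LHS](mulKmx ug) gqx0 mulmx0.
Qed.

Lemma quotient_map_mulr (r : nat) l c (g : 'M['F_2]_n) (q : 'M['F_2]_(r, n)) :
  g \in unitmx -> quotient_map [ffun v => g *m l v] [set c] q ->
  quotient_map l [set c] (q *m g).
Proof.
move=> ug /quotient_mapP[[B qB]]; rewrite ffunE => qc0 q_ker.
apply/quotient_mapP; split; last 1 first.
- move=> x; rewrite -mulmxA => /q_ker[t gx]; exists t.
  by rewrite -[x](mulKmx ug) gx -scalemxAr mulKmx.
- by exists (invmx g *m B); rewrite -mulmxA mulKVmx.
- by rewrite -mulmxA.
Qed.

End DJClasses.

(** * Faces of a wedge *)

Lemma in_join (A B : finType) (K : {set {set A}}) (L : {set {set B}})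
    (s : {set (A + B)%type}) :
  (s \in join K L) = (inl @^-1: s \in K) && (inr @^-1: s \in L).
Proof.
apply/imset2P/andP => [[a b Ka Lb ->]|[Ks Ls]].
  have -> : inl @^-1: (inl @: a :|: inr @: b) = a.
    apply/setP => x; rewrite !inE mem_imset; last exact: inl_inj.
    by case: imsetP => [[]|_] //; rewrite orbF.
  have -> // : inr @^-1: (inl @: a :|: inr @: b) = b.
    apply/setP => x; rewrite !inE orbC mem_imset; last exact: inr_inj.
    by case: imsetP => [[]|_] //; rewrite orbF.
exists (inl @^-1: s) (inr @^-1: s) => //; apply/setP => -[x|x]; rewrite !inE.
  rewrite mem_imset ?inE; last exact: inl_inj.
  by case: imsetP => [[]|_] //; rewrite orbF.
rewrite orbC mem_imset ?inE; last exact: inr_inj.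
by case: imsetP => [[]|_] //; rewrite orbF.
Qed.

Section Wedge.
Variables (V : finType) (p : V).
Implicit Types (K : {set {set V}}) (b : bool).

(* The cone with apex p_1 (b = false) or p_2 (b = true) over the copy of s in
   which p is renamed to the other of these two vertices. *)
Local Notation star b s :=
  ((inl b : wedge_vertex p) |: rename (inl (~~ b)) @: (s : {set V})).

Lemma rename_pole (c : wedge_vertex p) : rename c p = c.
Proof. by rewrite /rename insubF ?eqxx. Qed.

Lemma rename_off (c : wedge_vertex p) v (vNp : v != p) :
  rename c v = inr (Sub v vNp).
Proof. by rewrite /rename insubT. Qed.

Lemma rename_inr (c : wedge_vertex p) (u : {v : V | v != p}) :
  rename c (val u) = inr u.
Proof. by rewrite /rename valK. Qed.

Lemma rename_inj b : injective (@rename _ p (inl b)).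
Proof.
move=> u v; have [->|uNp] := eqVneq u p; have [->|vNp] := eqVneq v p => //.
- by rewrite rename_pole rename_off.
- by rewrite rename_pole rename_off.
- by rewrite !rename_off => -[].
Qed.

Lemma rename_neq b v : @rename _ p (inl (~~ b)) v != inl b.
Proof.
have [->|vNp] := eqVneq v p; last by rewrite rename_off.
by rewrite rename_pole; case: b.
Qed.

Lemma in_star_inl b b' (s : {set V}) :
  (inl b' \in star b s) = (b' == b) || (p \in s).
Proof.
rewrite !inE; have [->|b'Nb] := eqVneq b' b; first by rewrite eqxx.
have -> : b' = ~~ b by case: b b' b'Nb => -[].
rewrite (inj_eq inl_inj).
have -> : (~~ b == b) = false by case: b {b'Nb}.
by rewrite -{1}(rename_pole (inl (~~ b))) mem_imset //; apply: rename_inj.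
Qed.

Lemma in_star_inr b u (s : {set V}) : (inr u \in star b s) = (val u \in s).
Proof.
by rewrite !inE /= -(rename_inr (inl (~~ b)) u) mem_imset //; apply: rename_inj.
Qed.

(** The part t of a face away from p_1 and p_2 must be a face of K, and must
    also lie in the link of p if p_1 and p_2 are both present. *)
Lemma in_wed K (s : {set wedge_vertex p}) :
  simplicial_complex K ->
  (s \in wed p K) =
    let t := [set val u | u in inr @^-1: s] in
    (if inl @^-1: s == [set: bool] then p |: t else t) \in K.
Proof.
move=> [_ Ksub] /=; set t := [set val u | u in _].
have pNt : p \notin t by apply/imsetP => -[u _ pE]; case/eqP: (valP u).
rewrite /wed in_setU !in_join /off_p /full_simplex /boundary_simplex !inE.
rewrite -/t pNt disjoints1 pNt !andbT /=.
have Kpt : p |: t \in K -> t \in K by move/Ksub; apply; apply: subsetUr.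
case: eqP => _ /=; first by rewrite orbF; apply/andP/idP => [[]|/[dup]/Kpt].
by apply/orP/idP => [[/andP[]|]|]; [|by []|right].
Qed.

(** A face containing both p_1 and p_2 has a part in the link of p, to which p
    can be added back; it then fits in the cone with either apex.  A face missing
    one of them fits in the cone whose apex is the other one. *)
Lemma wedP K (s : {set wedge_vertex p}) :
  simplicial_complex K ->
  s \in wed p K <-> exists b, exists2 t, t \in K & s \subset star b t.
Proof.
move=> cK; have [_ Ksub] := cK; rewrite in_wed //=.
set t := [set val u | u in _].
have in_t u : inr u \in s -> val u \in t.
  by move=> su; apply/imsetP; exists u; rewrite ?inE.
split=> [|[b [r Kr /subsetP sub_s]]].
  case: eqP => [_ Kt|/eqP NsT Kt].
    exists true, (p |: t) => //; apply/subsetP => -[b|u] s_x.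
      by rewrite in_star_inl !inE eqxx orbT.
    by rewrite in_star_inr !inE in_t ?orbT.
  have [b sNb] : exists b, inl b \notin s.
    move: NsT; rewrite -subTset => /subsetPn[b _]; rewrite inE => sNb.
    by exists b.
  exists (~~ b), t => //; apply/subsetP => -[b'|u] s_x.
    rewrite in_star_inl; have : b' != b by apply: contraNneq sNb => <-.
    by case: b b' {sNb s_x} => -[].
  by rewrite in_star_inr in_t.
have sub_tr : t \subset r.
  apply/subsetP => _ /imsetP[u + ->]; rewrite inE => /sub_s.
  by rewrite in_star_inr.
apply: Ksub Kr _; case: eqP => // sT; rewrite subUset sub_tr andbT sub1set.
have /sub_s : inl (~~ b) \in s by have := in_setT (~~ b); rewrite -sT inE.
by rewrite in_star_inl; case: b {sub_s}.
Qed.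

Lemma vertices_link_wed K b v :
  simplicial_complex K -> v \in vertices K ->
  rename (inl (~~ b)) v \in vertices (link (wed p K) [set inl b]).
Proof.
move=> cK; rewrite inE => Kv; rewrite inE.
have sub x : [set x] \subset star b [set v] -> [set x] \in wed p K.
  by move=> sub_x; apply/wedP => //; exists b, [set v].
rewrite -(imset_set1 (rename _)) inE.
apply/andP; split; first by rewrite imset_set1 sub // -imset_set1 subsetUr.
apply/andP; split; first by apply/wedP => //; exists b, [set v].
by rewrite imset_set1 disjoints1 inE eq_sym rename_neq.
Qed.

Lemma vertices_wed K :
  simplicial_complex K -> vertices K = [set: V] -> vertices (wed p K) = setT.
Proof.
move=> cK vK; apply/setP => x; rewrite inE [RHS]inE; apply/wedP => //.
have Kv v : [set v] \in K by have := in_setT v; rewrite -vK inE.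
exists true, [set (if x is inr u then val u else p)] => //.
rewrite sub1set; case: x => [b|u]; last by rewrite in_star_inr inE.
by rewrite in_star_inl inE eqxx orbT.
Qed.

(** * Projections of a map over a wedge *)

(** An arbitrary member of the projected class is a projection of the chosen
    representative l, since the GL(N)-action can be absorbed in the quotient
    map. *)
Lemma mem_pullback_Proj K b (N r : nat)
    (l : {ffun wedge_vertex p -> 'cV['F_2]_N})
    (f : {ffun V -> 'cV['F_2]_r}) :
  simplicial_complex K -> vertices K = [set: V] ->
  f \in pullback (inl (~~ b)) (Proj (wed p K) [set inl b] r (DJ_class l)) ->
  exists2 q, quotient_map l [set inl b] q &
    forall v, f v = q *m l (rename (inl (~~ b)) v).
Proof.
move=> cK vK /imsetP[l1 + ->] => /imset2P[l2 q /imsetP[g ug ->]]; rewrite inE.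
move=> /(quotient_map_mulr ug) quo_q ->; exists (q *m g) => // v.
by rewrite !ffunE vertices_link_wed ?vK // mulmxA.
Qed.

Lemma pullback_Proj K b (N r : nat) (l : {ffun wedge_vertex p -> 'cV['F_2]_N})
    (q : 'M['F_2]_(r, N)) :
  simplicial_complex K -> vertices K = [set: V] ->
  quotient_map l [set inl b] q ->
  pullback (inl (~~ b)) (Proj (wed p K) [set inl b] r (DJ_class l)) =
  DJ_class [ffun v => q *m l (rename (inl (~~ b)) v)].
Proof.
move=> cK vK quo_q; apply/setP => f; apply/idP/imsetP => [|[g ug ->]].
  move=> /(mem_pullback_Proj cK vK)[q' quo_q' fE].
  have [h uh q'E] := quotient_map_unique quo_q quo_q'.
  by exists h => //; apply/ffunP => v; rewrite !ffunE fE q'E mulmxA.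
apply/imsetP; eexists.
  apply/imset2P; exists l (g *m q); [exact: DJ_class_refl | | by []].
  by rewrite inE quotient_map_mull.
by apply/ffunP => v; rewrite !ffunE vertices_link_wed ?vK // mulmxA.
Qed.

(** Each cone of [wedP] is independent because its base is, after projection
    from its apex; both apexes are needed to reach all faces of the wedge. *)
Lemma wed_free K (N r : nat) (l : wedge_vertex p -> 'cV['F_2]_N)
    (q : bool -> 'M['F_2]_(r, N)) :
  simplicial_complex K ->
  (forall b, q b *m l (inl b) = 0) -> (forall b, l (inl b) != 0) ->
  (forall b t, t \in K ->
     free [seq q b *m l (rename (inl (~~ b)) v) | v in t]) ->
  forall s, s \in wed p K -> free [seq l w | w in s].
Proof.
move=> cK ql0 ln0 frK s /wedP[] // b [t Kt sub_s].
apply: free_image_sub sub_s _; apply: (free_star _ _ (ql0 b)) => //.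
- exact: rename_inj.
- exact: rename_neq.
exact: frK.
Qed.

End Wedge.

(** * Comparing normal forms *)

Lemma block_shearE (n k : nat) (M1 M2 : 'M['F_2]_(n, k)) (p : 'I_(n + k))
    (psi : 'rV['F_2]_k) :
  let A := \matrix_(i < n, j < k) (row_mx 1%:M M1 i p * psi 0 j) in
  let h := block_mx 1%:M A 0 1%:M : 'M['F_2]_(n + k) in
  col_mx M2 1%:M = h *m col_mx M1 1%:M <->
  row_mx 1%:M M2 = row_mx 1%:M M1 + col p (row_mx 1%:M M1) *m row_mx 0 psi.
Proof.
move=> A h; have AE : A = col p (row_mx 1%:M M1) *m psi.
  by apply/matrixP => i j; rewrite [LHS]mxE [RHS]mxE big_ord1 [in RHS]mxE.
rewrite /h AE mul_block_col !mul1mx !mulmx1 mul0mx add0r.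
rewrite mul_mx_row mulmx0 add_row_mx addr0.
by split=> [/eq_col_mx[->]|/eq_row_mx[_ ->]].
Qed.

Section NormalForms.
Variables (n k : nat) (M1 M2 : 'M['F_2]_(n, k)) (p : 'I_(n + k)).
Let L1 : 'M_(n, n + k) := row_mx 1%:M M1.
Let L2 : 'M_(n, n + k) := row_mx 1%:M M2.

(** A section B of q1 splits the common source of q1 and q2 as im B + ker q1;
    applying q2 to the two components of l(v) gives L2(v) in terms of L1(v). *)
Lemma projections_differ_by_shear (N : nat)
    (l : {ffun wedge_vertex p -> 'cV['F_2]_N}) (q1 q2 : 'M['F_2]_(n, N)) :
  quotient_map l [set wedge_p2 p] q1 -> quotient_map l [set wedge_p1 p] q2 ->
  (forall v, col v L1 = q1 *m l (rename (wedge_p1 p) v)) ->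
  (forall v, col v L2 = q2 *m l (rename (wedge_p2 p) v)) ->
  col p L1 != 0 ->
  exists psi : 'rV['F_2]_k, L2 = L1 + col p L1 *m row_mx 0 psi.
Proof.
move=> /quotient_mapP[_ _ q1_ker] /quotient_mapP[_ q2p1 _] L1E L2E c1n0.
(* B lifts the unit vectors along q1; u is the row e_p^T if p <= n, else 0. *)
pose B : 'M_(N, n) := \matrix_(i, j) l (rename (wedge_p1 p) (lshift k j)) i 0.
have colB j : col j B = l (rename (wedge_p1 p) (lshift k j)).
  by apply/matrixP => i z; rewrite !mxE ord1.
have q1B : q1 *m B = 1%:M.
  by apply: eq_col_matrix => j; rewrite col_mulmx colB -L1E colKl.
have c1E : q1 *m l (wedge_p1 p) = col p L1 by rewrite L1E rename_pole.
have c2E : q2 *m l (wedge_p2 p) = col p L2 by rewrite L2E rename_pole.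
pose u : 'rV['F_2]_n := \row_j (lshift k j == p)%:R.
have q2B : q2 *m B = 1%:M - col p L1 *m u.
  apply: eq_col_matrix => j; rewrite linearB /= !col_mulmx colB.
  have -> : col j u = (lshift k j == p)%:R%:M.
    by apply/matrixP => i z; rewrite !mxE !ord1.
  rewrite mul_mx_scalar; have [jE|jNp] := eqVneq (lshift k j) p.
    by rewrite jE rename_pole q2p1 scale1r -jE !colKl subrr.
  by rewrite scale0r subr0 rename_off -(colKl j _ M2) L2E rename_off.
(* x - B (q1 x) lies in ker q1, the line of l(p_2). *)
have q2E x : exists t,
    q2 *m x = q1 *m x - col p L1 *m (u *m (q1 *m x)) + t *: col p L2.
  have /q1_ker[t xE] : q1 *m (x - B *m (q1 *m x)) = 0.
    by rewrite mulmxBr (mulmxA q1 B) q1B mul1mx subrr.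
  exists t; move/eqP: xE; rewrite subr_eq addrC => /eqP xE.
  rewrite {1}xE mulmxDr mulmxA q2B mulmxBl mul1mx -mulmxA.
  by rewrite -scalemxAr c2E.
(* For p > n, q2 kills l(p_1), so the previous formula at l(p_1) reads
   0 = L1(p) + t L2(p), and t = 1 because L1(p) is nonzero. *)
have c21 : col p L2 = col p L1.
  case: (split_ordP p) => j pE; first by rewrite pE !colKl.
  have [t] := q2E (l (wedge_p1 p)).
  have -> : u = 0 by apply/rowP => i; rewrite !mxE pE eq_lrshift.
  rewrite q2p1 c1E mul0mx mulmx0 subr0 => /esym/eqP.
  rewrite addr_eq0 => /eqP c1c2.
  have t1 : t = 1.
    apply/F2_neq0; apply: contraNneq c1n0 => t0.
    by rewrite c1c2 t0 scale0r oppr0.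
  by rewrite c1c2 t1 -scaleNr oppr_pchar2 ?scale1r // pchar_Fp.
have shear v : exists t, col v L2 = col v L1 + t *: col p L1.
  have [->|vNp] := eqVneq v p; first by exists 0; rewrite scale0r addr0.
  have [t] := q2E (l (rename (wedge_p1 p) v)).
  rewrite -L1E (_ : rename _ v = rename (wedge_p2 p) v); last first.
    by rewrite !rename_off.
  rewrite -L2E c21 [u *m _]mx11_scalar mul_mx_scalar -addrA -scaleNr -scalerDl.
  by move=> ->; eexists.
have /fin_all_exists[psi psiE] j := shear (rshift n j).
exists (\row_j psi j); rewrite mul_mx_row mulmx0 add_row_mx addr0.
congr row_mx; apply: eq_col_matrix => j; have := psiE j; rewrite !colKr => ->.
rewrite linearD /= col_mulmx; congr (_ + _); apply/matrixP => i z.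
by rewrite !mxE big_ord1 !mxE mulrC.
Qed.

(** The extra coordinate of the labels records the multipliers of c, and q b is
    the projection along the label of the vertex with index b. *)
Lemma projections_of_shear (psi : 'rV['F_2]_k) :
  L2 = L1 + col p L1 *m row_mx 0 psi -> col p L2 != 0 ->
  exists (l : {ffun wedge_vertex p -> 'cV['F_2]_(1 + n)})
         (q : bool -> 'M['F_2]_(n, 1 + n)),
  forall b,
    [/\ quotient_map l [set inl b] (q b),
        forall v,
          q b *m l (rename (inl (~~ b)) v) = col v (if b then L1 else L2)
      & l (inl b) != 0].
Proof.
move=> L2E c2n0; set c := col p L1.
pose a (v : 'I_(n + k)) : 'F_2 := (row_mx 0 psi : 'rV_(n + k)) 0 v.
have colL2 v : col v L2 = col v L1 + a v *: c.
  rewrite L2E linearD /= col_mulmx [col v (row_mx 0 psi)]mx11_scalar.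
  by rewrite mul_mx_scalar mxE.
(* L2(p) = (1 + a_p) c is nonzero, so its coefficient is 1. *)
have c21 : col p L2 = c.
  have c2E : col p L2 = (1 + a p) *: c by rewrite colL2 scalerDl scale1r.
  move: c2n0; rewrite c2E scaler_eq0 negb_or => /andP[/F2_neq0 -> _].
  by rewrite scale1r.
pose l : {ffun wedge_vertex p -> 'cV['F_2]_(1 + n)} :=
  [ffun w => match w with
             | inl b => col_mx 1%:M (if b then 0 else c)
             | inr u => col_mx (a (val u))%:M (col (val u) L1)
             end].
pose q b : 'M['F_2]_(n, 1 + n) := row_mx (if b then 0 else c) 1%:M.
have cc0 : c + c = 0.
  by rewrite -[c]scale1r -scalerDl addrr_pchar2 ?scale0r // pchar_Fp.
exists l, q => b; split.
- apply/quotient_mapP; split.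
  + by exists (col_mx 0 1%:M); rewrite /q mul_row_col mulmx0 add0r mulmx1.
  + by rewrite ffunE /q mul_row_col mulmx1 mul1mx; case: b; rewrite ?addr0.
  move=> x; rewrite -[x]vsubmxK /q mul_row_col mul1mx [usubmx x]mx11_scalar.
  set t := usubmx x 0 0; rewrite mul_mx_scalar => /eqP; rewrite addrC addr_eq0.
  move=> /eqP ->; exists t; rewrite ffunE scale_col_mx scalemx1.
  case: b; first by rewrite !scaler0 oppr0.
  by congr col_mx; apply/eqP; rewrite eq_sym -addr_eq0 -scalerDr cc0 scaler0.
- move=> v; have [->|vNp] := eqVneq v p.
    rewrite rename_pole ffunE /q mul_row_col mulmx1 mul1mx.
    by case: b; rewrite ?add0r ?addr0.
  rewrite rename_off ffunE /q mul_row_col mul1mx mul_mx_scalar.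
  by case: b; rewrite ?scaler0 ?add0r // colL2 addrC.
rewrite ffunE; apply/eqP => /(congr1 (fun x => usubmx x 0 0))/eqP.
by rewrite col_mxKu !mxE oner_eq0.
Qed.

End NormalForms.

Theorem lemma4p2 (R : realType) (n k : nat) (K : {set {set 'I_(n + k)}})
    (hK : PL_sphere R K) (hV : vertices K = [set: 'I_(n + k)])
    (hn : pure_complex K n) (h1n : facet K [set lshift k i | i : 'I_n])
    (X1 X2 : {set {ffun 'I_(n + k) -> 'cV['F_2]_n}})
    (hX1 : CM K X1) (hX2 : CM K X2)
    (M1 M2 : 'M['F_2]_(n, k))
    (hM1 : columns (row_mx 1%:M M1) \in X1)
    (hM2 : columns (row_mx 1%:M M2) \in X2)
    (p : 'I_(n + k)) :
  (exists2 X : {set {ffun wedge_vertex p -> 'cV['F_2]_n.+1}},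
     CM (wed p K) X & is_wedge K X X1 X2)
  <->
  (exists psi : 'rV['F_2]_k,
     let A := \matrix_(i < n, j < k) (row_mx 1%:M M1 i p * psi 0 j) in
     let h := block_mx 1%:M A 0 1%:M : 'M['F_2]_(n + k) in
     col_mx M2 1%:M = h *m col_mx M1 1%:M).
Proof.
have cK : simplicial_complex K by case: hK.
have [ch1 X1E] := CM_mem hX1 hM1; have [ch2 X2E] := CM_mem hX2 hM2.
have Kp : [set p] \in K by have := in_setT p; rewrite -hV inE.
have colp_neq0 M : characteristic_map K (columns (row_mx 1%:M M)) ->
    col p (row_mx 1%:M M) != 0.
  move=> /(characteristic_map_free hn)/(_ Kp)/free_image_neq0/(_ (set11 p)).
  by rewrite ffunE.
split=> [[_ [l _ ->] [P1 P2]] | [psi /block_shearE L2E]].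
  have [q1 quo1 L1E] : exists2 q, quotient_map l [set wedge_p2 p] q &
      forall v, columns (row_mx 1%:M M1) v = q *m l (rename (wedge_p1 p) v).
    by apply: (mem_pullback_Proj (b := true) cK hV); rewrite P1.
  have [q2 quo2 L2E] : exists2 q, quotient_map l [set wedge_p1 p] q &
      forall v, columns (row_mx 1%:M M2) v = q *m l (rename (wedge_p2 p) v).
    by apply: (mem_pullback_Proj (b := false) cK hV); rewrite P2.
  have [|||psi psiE] :=
    projections_differ_by_shear quo1 quo2 (M1 := M1) (M2 := M2).
  - by move=> v; rewrite -L1E ffunE.
  - by move=> v; rewrite -L2E ffunE.
  - exact: colp_neq0.
  by exists psi; apply/block_shearE.
have [l [q lq]] := projections_of_shear L2E (colp_neq0 M2 ch2).
have projE b : pullback (inl (~~ b)) (Proj (wed p K) [set inl b] n (DJ_class l))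
    = if b then X1 else X2.
  have [quo_q ql _] := lq b; rewrite (pullback_Proj cK hV quo_q).
  by case: b {quo_q} ql => ql; rewrite ?X1E ?X2E; congr DJ_class;
     apply/ffunP => v; rewrite !ffunE ql.
exists (DJ_class l); last first.
  by split; [apply: (projE true) | apply: (projE false)].
exists l => //; split=> [w|s [Ks _] _].
  by rewrite (vertices_wed p cK hV) inE.
apply: (wed_free (q := q) cK _ _ _ Ks) => b; have [quo_q ql ln0] := lq b => //.
  by case/quotient_mapP: quo_q.
move=> t Kt; rewrite /image_mem.
case: b {ln0} quo_q ql => _ ql.
  have := characteristic_map_free hn ch1 Kt; rewrite /image_mem.
  by congr free; apply: eq_map => v; rewrite ffunE ql.
have := characteristic_map_free hn ch2 Kt; rewrite /image_mem.
by congr free; apply: eq_map => v; rewrite ffunE ql.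
Qed.
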